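(* In the preemptive sUETS problem, the following online algorithm is $O(\log n/\log\log n)$-competitive. Let $q$ be the integer with $q^q\ge n>(q-1)^{q-1}$. If $m<2q$, assign the batch $J$ to one machine and stop. Otherwise, compute an $m$-partition $(X_1,\dots,X_m)$ of $J$ minimizing $\max_{i\in[m]}c(X_i)$, and set $R^{(0)}=J$. For each phase $k=1,2,\dots,q$: compute an $m$-partition $(Y^{(k)}_1,\dots,Y^{(k)}_m)$ of the set $R^{(k-1)}$ of uncompleted jobs such that for each $i\in[m]$, $|Y^{(k)}_i|\le n/q^{k-1}$ and $Y^{(k)}_i\subseteq X_j$ for some $j\in[m]$; assign batch $Y^{(k)}_i$ to machine $i$ for every $i$; let each machine process its batch until either the batch is completed or the number of machines with uncompleted batches becomes at most $\lfloor m/q\rfloor$, at which point all still-running batches are preempted; let $R^{(k)}$ be the set of uncompleted jobs. Finally (phase $q+1$), assign the remaining jobs of $R^{(q)}$ as singleton batches, at most one per machine.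
   Context: Preemptive sUETS: a finite set $J$ of $n$ jobs and $m$ identical machines, $n\ge m\ge 2$, all jobs available at time $0$. A known setup-time function $c:2^J\to\mathbb{R}_{\ge0}$ is monotone ($c(X)\le c(Y)$ for $X\subseteq Y$) and subadditive ($c(X)+c(Y)\ge c(X\cup Y)$ for disjoint $X,Y$). Each job $j$ has execution time $p_j\ge0$, unknown to an online algorithm until $j$ completes; $p(X)=\sum_{j\in X}p_j$. An algorithm forms batches (sets of jobs not completed and not assigned elsewhere) and assigns each batch to a single machine, which processes batch $X$ in time $c(X)+p(X)$ if uninterrupted. Processing may be preempted: if batch $X$ is preempted $t$ time units after its start, the machine becomes available after at most $c(X)+\max_{j\in X}p_j$ further time units, the set $X'\subseteq X$ of completed jobs satisfies $c(X)+p(X')+\max_{j\in X}p_j\ge t$, completed jobs need not be reprocessed, and uncompleted jobs may be regrouped into new batches (incurring setup again). The makespan is the completion time of all jobs. The optimal makespan is $\min_{(X_1,\dots,X_m)\text{ partition of }J}\max_i(c(X_i)+p(X_i))$. An algorithm is $\rho$-competitive if its makespan is at most $\rho$ times the optimal makespan on every instance; $O(\log n/\log\log n)$-competitive means there is an absolute constant $C$ such that this holds with $\rho=C\log n/\log\log n$ (for $n$ large enough that this is positive).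
   Formalization: A partition with |Y_i| ≤ n/q^{k-1} may not exist (the bound can drop below 1 with jobs left), so the algorithm is shown never to get stuck only with this bound rounded up; the competitive bound is proved for that version and for every complete run of the literal one. *)

(* Defs.v *)
From mathcomp Require Import all_boot all_order all_algebra.
From mathcomp Require Import reals exp.

Set Implicit Arguments.
Unset Strict Implicit.
Unset Printing Implicit Defensive.

Import Order.TTheory GRing.Theory Num.Theory.
Local Open Scope ring_scope.

Record sUETS_instance (R : realType) (J : finType) (m : nat)
    (c : {set J} -> R) (p : J -> R) : Prop := SUETSInstance {
  machines_ge2 : (2 <= m)%N;
  machines_le_jobs : (m <= #|J|)%N;
  setup_ge0 : forall X : {set J}, 0 <= c X;
  setup_monotone : forall X Y : {set J}, X \subset Y -> c X <= c Y;
  setup_subadditive : forall X Y : {set J},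
    [disjoint X & Y] -> c (X :|: Y) <= c X + c Y;
  exec_ge0 : forall j : J, 0 <= p j }.

Definition total_exec (R : realType) (J : finType) (p : J -> R)
  (X : {set J}) : R := \sum_(j in X) p j.

(* As execution times are nonnegative, the default value 0 only matters for
   the empty set. *)
Definition max_exec (R : realType) (J : finType) (p : J -> R)
  (X : {set J}) : R := \big[Num.max/0]_(j in X) p j.

Definition proc_time (R : realType) (J : finType) (c : {set J} -> R)
  (p : J -> R) (X : {set J}) : R := c X + total_exec p X.

(* Blocks may be empty: the sets to be partitioned can have fewer than m
   elements. *)
Definition mpartition (J : finType) (m : nat) (S : {set J})
    (X : {ffun 'I_m -> {set J}}) : bool :=
  [forall i, forall j, (i != j) ==> [disjoint X i & X j]]
  && (\bigcup_i X i == S).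

Definition max_load (R : realType) (J : finType) (m : nat)
    (c : {set J} -> R) (p : J -> R) (X : {ffun 'I_m -> {set J}}) : R :=
  \big[Num.max/0]_(i < m) proc_time c p (X i).

Definition max_setup (R : realType) (J : finType) (m : nat)
    (c : {set J} -> R) (X : {ffun 'I_m -> {set J}}) : R :=
  \big[Num.max/0]_(i < m) c (X i).

(* Only a witness that [setT] has an m-partition when 0 < m, as required by
   [arg min]. *)
Definition one_machine_partition (J : finType) (m : nat) :
    {ffun 'I_m -> {set J}} :=
  [ffun i => if val i == 0%N then [set: J] else set0].

Definition opt_makespan (R : realType) (J : finType) (m : nat)
    (c : {set J} -> R) (p : J -> R) : R :=
  max_load c p
    [arg min_(X < one_machine_partition J m | mpartition [set: J] X)
       max_load c p X]%O.

(* A machine starts batch X at relative time 0 and is preempted at relative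
   time t if X is still uncompleted then.  D is the set of jobs it completes,
   r the relative time at which it is available again.  Apart from the stated
   constraints, D and r are arbitrary. *)
Definition batch_outcome (R : realType) (J : finType) (c : {set J} -> R)
    (p : J -> R) (X : {set J}) (t : R) (D : {set J}) (r : R) : Prop :=
  if proc_time c p X <= t then D = X /\ r = proc_time c p X
  else [/\ D \subset X,
           t <= c X + total_exec p D + max_exec p X,
           t <= r & r <= t + (c X + max_exec p X)].

Definition is_base (n q : nat) : Prop := (q.-1 ^ q.-1 < n <= q ^ q)%N.

(* Bounds on the size of the batches of a phase, phases being numbered from 0.
   A partition obeying [size_bound] need not exist: the bound can be smaller
   than 1 in the last phases although jobs are left.  Rounding up repairs this;
   partitions obeying [size_bound] also obey [size_bound_up]. *)
Definition size_bound (R : realType) (n q k : nat) : R := n%:R / q%:R ^+ k.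

Definition size_bound_up (R : realType) (n q k : nat) : R :=
  (Num.ceil (size_bound R n q k))%:~R.

Definition min_setup_partition (R : realType) (J : finType) (m : nat)
    (c : {set J} -> R) (X : {ffun 'I_m -> {set J}}) : Prop :=
  mpartition [set: J] X /\
  forall X' : {ffun 'I_m -> {set J}},
    mpartition [set: J] X' -> max_setup c X <= max_setup c X'.

Definition phase_partition (R : realType) (J : finType) (m : nat) (b : R)
    (X : {ffun 'I_m -> {set J}}) (U : {set J})
    (Y : {ffun 'I_m -> {set J}}) : Prop :=
  mpartition U Y /\
  forall i : 'I_m, #|Y i|%:R <= b /\ exists j : 'I_m, Y i \subset X j.

Definition running (R : realType) (J : finType) (m : nat) (c : {set J} -> R)
    (p : J -> R) (Y : {ffun 'I_m -> {set J}}) (s : R) : nat :=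
  #|[set i : 'I_m | s < proc_time c p (Y i)]|.

(* t is the first time at which at most m / q (rounded down) batches are
   uncompleted. *)
Definition preemption_time (R : realType) (J : finType) (m : nat)
    (c : {set J} -> R) (p : J -> R) (q : nat)
    (Y : {ffun 'I_m -> {set J}}) (t : R) : Prop :=
  [/\ 0 <= t, (running c p Y t <= m %/ q)%N
    & forall s : R, 0 <= s < t -> (m %/ q < running c p Y s)%N].

(* [latest] is the completion time of the jobs completed so far. *)
Record state (R : realType) (J : finType) := State {
  uncompleted : {set J};
  clock : R;
  latest : R }.

(* A job counts as completed when the machine processing its batch becomes
   available, and the next phase starts once all machines are available. *)
Definition phase (R : realType) (J : finType) (m : nat) (c : {set J} -> R)
    (p : J -> R) (q : nat) (b : R) (X : {ffun 'I_m -> {set J}})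
    (st st' : state R J) : Prop :=
  exists (Y : {ffun 'I_m -> {set J}}) (t : R)
         (D : 'I_m -> {set J}) (r : 'I_m -> R),
  [/\ phase_partition b X (uncompleted st) Y,
      preemption_time c p q Y t,
      forall i : 'I_m, batch_outcome c p (Y i) t (D i) (r i)
    & st' = State (uncompleted st :\: \bigcup_i D i)
                  (clock st + \big[Num.max/0]_(i < m) r i)
                  (\big[Num.max/latest st]_(i < m | D i != set0)
                      (clock st + r i))].

Inductive reached (R : realType) (J : finType) (m : nat) (c : {set J} -> R)
    (p : J -> R) (q : nat) (bound : nat -> R) (X : {ffun 'I_m -> {set J}}) :
    nat -> state R J -> Prop :=
| reached0 : reached c p q bound X 0 (State [set: J] 0 0)
| reachedS (k : nat) (st st' : state R J) :
    reached c p q bound X k st -> phase c p q (bound k) X st st' ->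
    reached c p q bound X k.+1 st'.

Definition singleton_assignment (J : finType) (m : nat) (U : {set J})
    (f : J -> 'I_m) : Prop := {in U &, injective f}.

(* T is a possible makespan: the choices the algorithm leaves open (partitions,
   machines of the singletons) and the outcomes of preemptions are
   nondeterministic.  In particular no choice needs to look at p. *)
Definition makespan (R : realType) (J : finType) (m : nat) (c : {set J} -> R)
    (p : J -> R) (q : nat) (bound : nat -> R) (T : R) : Prop :=
  if (m < 2 * q)%N then T = proc_time c p [set: J]
  else exists (X : {ffun 'I_m -> {set J}}) (st : state R J) (f : J -> 'I_m),
    [/\ min_setup_partition c X,
        reached c p q bound X q st,
        singleton_assignment (uncompleted st) f
      & T = \big[Num.max/latest st]_(j in uncompleted st)
               (clock st + proc_time c p [set j])].

(* Whatever happened before, the next phase can be carried out (in particular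
   the partition it requires exists), and the jobs left after phase q fit on
   the machines as singletons. *)
Definition executable (R : realType) (J : finType) (m : nat)
    (c : {set J} -> R) (p : J -> R) (q : nat) (bound : nat -> R) : Prop :=
  (2 * q <= m)%N ->
  (exists X : {ffun 'I_m -> {set J}}, min_setup_partition c X) /\
  forall X : {ffun 'I_m -> {set J}}, min_setup_partition c X ->
    (forall (k : nat) (st : state R J), (k < q)%N ->
       reached c p q bound X k st ->
       exists st' : state R J, phase c p q (bound k) X st st') /\
    (forall st : state R J, reached c p q bound X q st ->
       exists f : J -> 'I_m, singleton_assignment (uncompleted st) f).

Definition rate (R : realType) (n : nat) : R := ln n%:R / ln (ln n%:R).

(* Main.v *)
Require Import Defs.
From mathcomp Require Import all_boot all_order all_algebra.
From mathcomp Require Import reals exp.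
From mathcomp Require Import lra zify.

(** Write OPT for the optimal makespan.  Every batch of a phase lies in a block of
    an m-partition of minimal setup, so its setup time, like every execution
    time, is at most OPT.  More than m / q machines are still running just before
    the preemption time t of a phase, and each of them executes at least
    t - 2 OPT units of jobs that complete in this phase.  Summed over
    these machines and the q phases this is at most p(J) <= m OPT, so the preemption times add up to O(q)
    OPT, and the phases, each lasting at most t + 2 OPT, do too.  Finally
    (q - 1) ln (q - 1) < ln n <= q ln q gives q = O(ln n / ln ln n).

    The jobs left after a phase lie in at most m / q of its batches; cutting each
    of these into q pieces yields the batches of the next phase. *)

Set Implicit Arguments.
Unset Strict Implicit.
Unset Printing Implicit Defensive.

Import Order.TTheory GRing.Theory Num.Theory.
Local Open Scope ring_scope.

(** * Growth of [q] against the rate *)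

Lemma is_base_le_rate (R : realType) (n q : nat) :
  is_base n q -> 0 < rate R n -> q%:R <= 8 * rate R n.
Proof.
move=> /andP[lo hi] rate_gt0.
(* As [ln] vanishes at 0 and at 1, the rate is 0 for n <= 1. *)
have n_gt1 : (1 < n)%N.
  case: n rate_gt0 {lo hi} => [|[|n]] //; rewrite /rate.
    by rewrite ln0 ?mul0r ?ltxx.
  by rewrite ln1 mul0r ltxx.
have q_gt1 : (1 < q)%N by case: q hi {lo} => [|[|q]] //; rewrite ?exp1n; lia.
have q0 : 0 < q%:R :> R by rewrite ltr0n; lia.
have L0 : 0 < ln n%:R :> R by rewrite ln_gt0 // ltr1n.
have l0 : 0 < ln (ln n%:R) :> R.
  by move: rate_gt0; rewrite /rate pmulr_rgt0 // invr_gt0.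
have lnq_le : ln q%:R <= q%:R :> R by apply/ltW/ln_sublinear.
have L_le : ln n%:R <= q%:R * ln q%:R :> R.
  by rewrite mulr_natl -lnXn // -natrX ler_ln ?posrE ?ltr0n ?ler_nat; lia.
have lnq0 : 0 < ln q%:R :> R by rewrite ln_gt0 // ltr1n.
have l_le : ln (ln n%:R) <= 2 * ln q%:R :> R.
  rewrite mulr_natl -lnXn // ler_ln ?posrE ?exprn_gt0 //.
  by apply: le_trans L_le _; rewrite expr2 ler_wpM2l // ltW.
(* Passing from q to q - 1 costs a factor 2 in each factor of q ln q: q <= 2 (q - 1), and q <= (q -
   1)^2 gives ln q <= 2 ln (q - 1). The latter requires q >= 3, so q = 2 is treated apart. *)
have qlnq_le : q%:R * ln q%:R <= 4 * ln n%:R :> R.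
  have [q_le2|q_gt2] := leqP q 2.
    have -> : q = 2%N by lia.
    have : ln 2 <= ln n%:R :> R by rewrite ler_ln ?posrE ?ltr0n ?ler_nat; lia.
    by move: L0; lra.
  have lnq1_le : ln q%:R <= 2 * ln q.-1%:R :> R.
    rewrite mulr_natl -lnXn ?ltr0n; last by lia.
    by rewrite -natrX ler_ln ?posrE ?ltr0n ?ler_nat; nia.
  have q1_le : q.-1%:R * ln q.-1%:R <= ln n%:R :> R.
    rewrite mulr_natl -lnXn ?ltr0n; last by lia.
    rewrite -natrX ler_ln ?posrE ?ltr0n ?ler_nat ?expn_gt0 ?(ltnW lo) //; lia.
  have q_le : q%:R <= 2 * q.-1%:R :> R by rewrite -natrM ler_nat; lia.
  have := ler_pM (ltW q0) (ltW lnq0) q_le lnq1_le; lra.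
(* The 8 arises from q ln ln n <= 2 q ln q <= 8 ln n. *)
rewrite /rate mulrA ler_pdivlMr //.
by have := ler_wpM2l (ltW q0) l_le; lra.
Qed.

(** * Partitions and lower bounds on the optimal makespan *)

Lemma mpartition_disjoint (J : finType) (m : nat) (S : {set J})
    (X : {ffun 'I_m -> {set J}}) (i j : 'I_m) :
  mpartition S X -> i != j -> [disjoint X i & X j].
Proof. by move=> /andP[/forallP/(_ i)/forallP/(_ j)/implyP]. Qed.

Lemma mpartition_cover (J : finType) (m : nat) (S : {set J})
    (X : {ffun 'I_m -> {set J}}) :
  mpartition S X -> \bigcup_i X i = S.
Proof. by move=> /andP[_ /eqP]. Qed.

(** Both [one_machine_partition] and the refinement in [split_blocks] arise from labelling jobs by
    machines. *)
Lemma fibers_mpartition (J : finType) (m : nat) (S : {set J}) (f : J -> 'I_m) :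
  mpartition S [ffun i => [set x in S | f x == i]].
Proof.
apply/andP; split.
  apply/forallP => i; apply/forallP => j; apply/implyP => ij; rewrite !ffunE.
  rewrite -setI_eq0; apply/eqP/setP => x; rewrite !inE.
  apply: contraNF ij => /andP[/andP[_ /eqP <-] /andP[_ /eqP <-]] //.
apply/eqP/setP => x; apply/bigcupP/idP => [[i _]|xS].
  by rewrite ffunE inE => /andP[].
by exists (f x) => //; rewrite ffunE inE xS /=.
Qed.

Lemma one_machine_mpartition (J : finType) (m : nat) :
  (0 < m)%N -> mpartition [set: J] (one_machine_partition J m).
Proof.
case: m => // m _; have := @fibers_mpartition J _ [set: J] (fun=> ord0 : 'I_m.+1).
congr mpartition; apply/ffunP => i; rewrite !ffunE.
by apply/setP => x; rewrite !inE /= eq_sym -val_eqE /=; case: ifP; rewrite inE.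
Qed.

Lemma total_exec_ge0 (R : realType) (J : finType) (p : J -> R) (X : {set J}) :
  (forall j, 0 <= p j) -> 0 <= total_exec p X.
Proof. by move=> p_ge0; apply: sumr_ge0 => j _. Qed.

Lemma total_exec_bigcup (R : realType) (J : finType) (m : nat) (p : J -> R)
    (X : 'I_m -> {set J}) :
  (forall i j, i != j -> [disjoint X i & X j]) ->
  total_exec p (\bigcup_i X i) = \sum_i total_exec p (X i).
Proof. exact: partition_disjoint_bigcup. Qed.

Lemma setup_bigcup_le (R : realType) (J : finType) (m : nat) (c : {set J} -> R)
    (p : J -> R) (X : 'I_m -> {set J}) :
  sUETS_instance m c p -> c (\bigcup_i X i) <= \sum_i c (X i).
Proof.
case=> m_ge2 _ _ c_mono c_sub _.
(* Subadditivity is assumed for disjoint sets only; replacing B by B minus A and using monotonicity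
   extends it to all pairs. *)
have c_setU A B : c (A :|: B) <= c A + c B.
  have -> : A :|: B = A :|: (B :\: A).
    by apply/setP => x; rewrite !inE; case: (x \in A).
  apply: le_trans (c_sub _ _ _) _; last by rewrite lerD2l c_mono ?subsetDl.
  by rewrite -setI_eq0 setDE setICA setICr setI0.
(* The induction starts at one block: for an empty family the claim would be [c set0 <= 0], which
   may fail. *)
case: m X m_ge2 => // m X _; elim: m X => [|m IH] X; first by rewrite !big_ord1.
rewrite big_ord_recr [leRHS]big_ord_recr /=.
by apply: le_trans (c_setU _ _) _; rewrite lerD2r IH.
Qed.

Lemma opt_makespan_partition (R : realType) (J : finType) (m : nat)
    (c : {set J} -> R) (p : J -> R) :
  (0 < m)%N ->
  exists2 X : {ffun 'I_m -> {set J}}, mpartition [set: J] X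
    & forall i, proc_time c p (X i) <= opt_makespan m c p.
Proof.
move=> m_gt0; rewrite /opt_makespan.
case: arg_minP => [|X partX _]; first exact: one_machine_mpartition.
by exists X => // i; apply: (le_bigmax 0 (fun j => proc_time c p (X j))).
Qed.

(** Sum over the blocks of an optimal partition: setups are subadditive, execution times additive.
    This settles the case m < 2 q and, with the setup dropped, bounds p(J). *)
Lemma proc_timeT_le_opt (R : realType) (J : finType) (m : nat)
    (c : {set J} -> R) (p : J -> R) :
  sUETS_instance m c p ->
  proc_time c p [set: J] <= m%:R * opt_makespan m c p.
Proof.
move=> inst; have m_gt0 : (0 < m)%N by case: inst => m_ge2 *; lia.
have [X partX X_le] := opt_makespan_partition c p m_gt0.
rewrite /proc_time -(mpartition_cover partX) total_exec_bigcup; last first.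
  by move=> i j; apply: mpartition_disjoint partX.
have /le_trans -> // :
    c (\bigcup_i X i) + \sum_i total_exec p (X i) <= \sum_i proc_time c p (X i).
  by rewrite big_split lerD2r /= (setup_bigcup_le _ inst).
apply: le_trans (ler_sum _ (fun i _ => X_le i)) _.
by rewrite sumr_const card_ord mulr_natl.
Qed.

Lemma total_execT_le_opt (R : realType) (J : finType) (m : nat)
    (c : {set J} -> R) (p : J -> R) :
  sUETS_instance m c p ->
  total_exec p [set: J] <= m%:R * opt_makespan m c p.
Proof.
move=> inst; apply: le_trans (proc_timeT_le_opt inst).
by case: inst => _ _ c_ge0 *; rewrite lerDr.
Qed.

Lemma proc_time1_le_opt (R : realType) (J : finType) (m : nat)
    (c : {set J} -> R) (p : J -> R) (j : J) :
  sUETS_instance m c p -> proc_time c p [set j] <= opt_makespan m c p.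
Proof.
move=> inst; have m_gt0 : (0 < m)%N by case: inst => m_ge2 *; lia.
have [X partX X_le] := opt_makespan_partition c p m_gt0.
have : j \in \bigcup_i X i by rewrite (mpartition_cover partX).
case/bigcupP => i _ jXi; apply: le_trans (X_le i).
case: inst => _ _ _ c_mono _ p_ge0; apply: lerD; first by rewrite c_mono ?sub1set.
rewrite /total_exec big_set1 (big_setD1 j) //= lerDl.
exact: total_exec_ge0.
Qed.

Lemma exec_le_opt (R : realType) (J : finType) (m : nat)
    (c : {set J} -> R) (p : J -> R) (j : J) :
  sUETS_instance m c p -> p j <= opt_makespan m c p.
Proof.
move=> inst; apply: le_trans (proc_time1_le_opt j inst).
by case: inst => _ _ c_ge0 *; rewrite /proc_time /total_exec big_set1 lerDr.
Qed.

Lemma opt_makespan_ge0 (R : realType) (J : finType) (m : nat)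
    (c : {set J} -> R) (p : J -> R) :
  0 <= opt_makespan m c p.
Proof. exact: bigmax_ge_id. Qed.

(** An optimal partition competes in the minimization of the largest setup, and each of its setups
    is at most OPT. *)
Lemma min_setup_le_opt (R : realType) (J : finType) (m : nat)
    (c : {set J} -> R) (p : J -> R) (X : {ffun 'I_m -> {set J}}) (i : 'I_m) :
  sUETS_instance m c p -> min_setup_partition c X ->
  c (X i) <= opt_makespan m c p.
Proof.
move=> inst [_ X_min]; have m_gt0 : (0 < m)%N by case: inst => m_ge2 *; lia.
have [Z partZ Z_le] := opt_makespan_partition c p m_gt0.
apply: le_trans (le_bigmax 0 (c \o X) i) (le_trans (X_min _ partZ) _).
apply: bigmax_le => [|j _]; first exact: opt_makespan_ge0.
apply: le_trans (Z_le j); rewrite lerDl total_exec_ge0 //.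
by case: inst.
Qed.

Lemma min_setup_exists (R : realType) (J : finType) (m : nat)
    (c : {set J} -> R) :
  (0 < m)%N -> exists X : {ffun 'I_m -> {set J}}, min_setup_partition c X.
Proof.
move=> m_gt0.
have [X partX X_min] :=
  arg_minP (max_setup c) (one_machine_mpartition J m_gt0).
by exists X.
Qed.

(** * Progress within a phase and the bound on the makespan *)

Lemma preemption_count (R : realType) (J : finType) (m : nat)
    (c : {set J} -> R) (p : J -> R) (q : nat) (Y : {ffun 'I_m -> {set J}})
    (t : R) :
  (0 < q)%N -> preemption_time c p q Y t -> 0 < t ->
  (m <= q * #|[set i | (t <= proc_time c p (Y i))%R]|)%N.
Proof.
move=> q_gt0 [_ _ many] t_gt0.
(* Let s be the largest processing time below t, or 0 if there is none. A batch still running at s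
   has processing time at least t, and more than [m %/ q] batches run at s < t. *)
set s := \big[Num.max/0]_(i < m | proc_time c p (Y i) < t) proc_time c p (Y i).
have s_ge0 : 0 <= s by apply: bigmax_ge_id.
have s_lt : s < t by apply: bigmax_lt.
have := many s; rewrite s_ge0 s_lt => /(_ isT) many_s.
have /subset_leq_card : [set i : 'I_m | s < proc_time c p (Y i)]
    \subset [set i | t <= proc_time c p (Y i)].
  apply/subsetP => i; rewrite !inE; apply: contraLR; rewrite -ltNge -leNgt => lt_t.
  exact: (le_bigmax_cond _ (fun i => proc_time c p (Y i))).
move=> /(leq_trans many_s); have := ltn_ceil m q_gt0.
by move=> ? le_card; rewrite (leq_trans (ltnW _) (leq_mul (leqnn q) le_card)) // mulnC.
Qed.

Lemma max_exec_le (R : realType) (J : finType) (p : J -> R) (X : {set J})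
    (B : R) :
  0 <= B -> (forall j, p j <= B) -> max_exec p X <= B.
Proof. by move=> *; apply: bigmax_le. Qed.

Lemma batch_outcome_sub (R : realType) (J : finType) (c : {set J} -> R)
    (p : J -> R) (X : {set J}) (t : R) (D : {set J}) (r : R) :
  batch_outcome c p X t D r -> D \subset X.
Proof. by rewrite /batch_outcome; case: ifP => _ [] // ->. Qed.

Lemma batch_outcome_le (R : realType) (J : finType) (c : {set J} -> R)
    (p : J -> R) (X : {set J}) (t : R) (D : {set J}) (r : R) (B : R) :
  c X <= B -> max_exec p X <= B -> 0 <= B ->
  batch_outcome c p X t D r -> r <= t + 2 * B.
Proof.
rewrite /batch_outcome; case: ifP => [le_t ? ? ? [_ ->]|_ ? ? ? [_ _ _ ?]]; lra.
Qed.

(** One B pays for the setup, the other for the slack of one job that a preemption may cost. A batch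
    ending exactly at t is completed and loses only its setup. *)
Lemma batch_outcome_exec (R : realType) (J : finType) (c : {set J} -> R)
    (p : J -> R) (X : {set J}) (t : R) (D : {set J}) (r : R) (B : R) :
  c X <= B -> max_exec p X <= B -> 0 <= B ->
  t <= proc_time c p X -> batch_outcome c p X t D r ->
  t <= total_exec p D + 2 * B.
Proof.
rewrite /batch_outcome => cX pX B_ge0; case: ifP => [_|_ _ [_ ? _ _]]; last lra.
by rewrite /proc_time => ? [-> _]; lra.
Qed.

(** Of the 4 B, two cover the time until all machines are available again after t, and two the setup
    and lost work of a batch before t. The factor q compares all m machines with those busy until
    t. *)
Lemma phase_progress (R : realType) (J : finType) (m : nat)
    (c : {set J} -> R) (p : J -> R) (q : nat) (b B : R)
    (X : {ffun 'I_m -> {set J}}) (st st' : state R J) :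
  sUETS_instance m c p -> (0 < q)%N -> 0 <= B ->
  (forall i, c (X i) <= B) -> (forall j, p j <= B) ->
  phase c p q b X st st' ->
  m%:R * (clock st' - clock st - 4 * B) <=
  q%:R * (total_exec p (uncompleted st) - total_exec p (uncompleted st')).
Proof.
move=> [_ _ _ c_mono _ p_ge0] q_gt0 B_ge0 cX_le p_le.
case=> Y [t [D [r [[partY Y_b] t_pre out ->]]]] /=.
have cY_le i : c (Y i) <= B.
  by have [_ [j YX]] := Y_b i; apply: le_trans (c_mono _ _ YX) (cX_le j).
have maxY_le i : max_exec p (Y i) <= B by apply: max_exec_le.
have t_ge0 : 0 <= t by case: t_pre.
have r_le : \big[Num.max/0]_(i < m) r i <= t + 2 * B.
  apply: bigmax_le => [|i _]; first lra.
  exact: batch_outcome_le (out i).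
have D_sub i : D i \subset Y i := batch_outcome_sub (out i).
have D_disj i j : i != j -> [disjoint D i & D j].
  move=> /(mpartition_disjoint partY) disjY.
  exact: disjointWl (D_sub i) (disjointWr (D_sub j) disjY).
have UD_sub : \bigcup_i D i \subset uncompleted st.
  rewrite -(mpartition_cover partY); apply/bigcupsP => i _.
  exact: subset_trans (D_sub i) (bigcup_sup _ _).
have -> : total_exec p (uncompleted st) -
    total_exec p (uncompleted st :\: \bigcup_i D i) = \sum_i total_exec p (D i).
  rewrite -total_exec_bigcup // /total_exec (big_setID (\bigcup_i D i)) /=.
  by rewrite (setIidPr UD_sub) addrK.
apply: (@le_trans _ _ (m%:R * (t - 2 * B))).
  by rewrite ler_wpM2l ?ler0n //; lra.
(* For t <= 2 B the left side is nonpositive. Otherwise t > 0, and the count of long batches can be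
   multiplied by t - 2 B. *)
have [t_le|t_gt] := leP t (2 * B).
  apply: (@le_trans _ _ 0).
    by rewrite mulr_ge0_le0 ?ler0n //; lra.
  by rewrite mulr_ge0 ?ler0n // sumr_ge0 // => i _; apply: total_exec_ge0.
have t_gt0 : 0 < t by lra.
have := preemption_count q_gt0 t_pre t_gt0; set I := [set i | _] => m_le.
apply: (@le_trans _ _ (q%:R * (#|I|%:R * (t - 2 * B)))).
  by rewrite mulrA ler_wpM2r ?subr_ge0 ?(ltW t_gt) // -natrM ler_nat.
rewrite ler_wpM2l ?ler0n // mulr_natl -sumr_const.
rewrite [leRHS](bigID (mem I)) /= -[leLHS]addr0 lerD ?sumr_ge0 //; last first.
  by move=> i _; apply: total_exec_ge0.
apply: ler_sum => i; rewrite inE => t_le; rewrite lerBlDr.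
exact: batch_outcome_exec (out i).
Qed.

Lemma phase_latest_le_clock (R : realType) (J : finType) (m : nat)
    (c : {set J} -> R) (p : J -> R) (q : nat) (b : R)
    (X : {ffun 'I_m -> {set J}}) (st st' : state R J) :
  latest st <= clock st -> phase c p q b X st st' -> latest st' <= clock st'.
Proof.
move=> le_clock [Y [t [D [r [_ _ _ ->]]]]] /=.
apply: bigmax_le => [|i _]; last by rewrite lerD2l le_bigmax.
by rewrite (le_trans le_clock) // lerDl bigmax_ge_id.
Qed.

(** The inequality of [phase_progress] telescopes over the phases; [latest] never exceeds [clock],
    so it suffices to bound the clock. *)
Lemma reached_bound (R : realType) (J : finType) (m : nat)
    (c : {set J} -> R) (p : J -> R) (q : nat) (bound : nat -> R) (B : R)
    (X : {ffun 'I_m -> {set J}}) (k : nat) (st : state R J) :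
  sUETS_instance m c p -> (0 < q)%N -> 0 <= B ->
  (forall i, c (X i) <= B) -> (forall j, p j <= B) ->
  reached c p q bound X k st ->
  latest st <= clock st /\
  m%:R * (clock st - k%:R * (4 * B)) <=
  q%:R * (total_exec p [set: J] - total_exec p (uncompleted st)).
Proof.
move=> inst q_gt0 B_ge0 cX_le p_le.
elim=> [|{}k {}st st' _ [latest_le IH] ph].
  by rewrite /= !subrr mul0r subrr !mulr0.
split; first exact: phase_latest_le_clock ph.
have := phase_progress inst q_gt0 B_ge0 cX_le p_le ph.
rewrite -natr1; lra.
Qed.

(** The phases take 4 q OPT of overhead plus q OPT for p(J) <= m OPT, and the singletons at most one
    more OPT. Batch sizes do not enter, so [bound] is arbitrary. *)
Lemma makespan_le (R : realType) (J : finType) (m : nat)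
    (c : {set J} -> R) (p : J -> R) (q : nat) (bound : nat -> R) (T : R) :
  sUETS_instance m c p -> (0 < q)%N -> makespan m c p q bound T ->
  T <= 6 * q%:R * opt_makespan m c p.
Proof.
move=> inst q_gt0; have B_ge0 := opt_makespan_ge0 m c p.
have m_gt0 : (0 < m)%N by case: inst => m_ge2 *; lia.
set B := opt_makespan m c p in B_ge0 *.
have q_ge1 : 1 <= q%:R :> R by rewrite ler1n.
rewrite /makespan; case: ltnP => [lt_m ->|_ [X [st [f [X_min reach _ ->]]]]].
  apply: le_trans (proc_timeT_le_opt inst) _; rewrite ler_wpM2r //.
  by rewrite -natrM ler_nat; lia.
have [latest_le] := reached_bound inst q_gt0 B_ge0
  (fun i => min_setup_le_opt i inst X_min) (fun j => exec_le_opt j inst) reach.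
have total_le := total_execT_le_opt inst.
have Ust_ge0 : 0 <= total_exec p (uncompleted st).
  by apply: total_exec_ge0; case: inst.
move=> clock_le.
have clock_le5 : clock st <= 5 * q%:R * B.
  suff : m%:R * (clock st - q%:R * (4 * B)) <= m%:R * (q%:R * B).
    by rewrite ler_pM2l ?ltr0n //; lra.
  apply: le_trans clock_le _; rewrite mulrCA ler_wpM2l ?ler0n //.
  by rewrite -/B in total_le; lra.
have B_le : B <= q%:R * B by rewrite ler_peMl.
apply: bigmax_le => [|j _]; first lra.
by have := proc_time1_le_opt j inst; rewrite -/B; lra.
Qed.

(** * Executability: existence of preemption times, partitions and singleton assignments *)

Lemma preemption_time_exists (R : realType) (J : finType) (m : nat)
    (c : {set J} -> R) (p : J -> R) (q : nat) (Y : {ffun 'I_m -> {set J}}) :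
  exists t, preemption_time c p q Y t.
Proof.
(* The number of running batches changes only at processing times, so the candidates for t are these
   and time 0, encoded by [None]. The largest candidate qualifies, and t is the least that does. *)
pose F (o : option 'I_m) : R := if o is Some i then proc_time c p (Y i) else 0.
pose P o := (0 <= F o) && (running c p Y (F o) <= m %/ q)%N.
have [o1 _ o1_max] := arg_maxP F (erefl : predT (@None 'I_m)).
have P_o1 : P o1.
  rewrite /P (o1_max None isT : 0 <= F o1) /running (_ : [set _ | _] = set0) ?cards0 //.
  apply/setP => i; rewrite !inE; apply/negbTE; rewrite -leNgt.
  exact: (o1_max (Some i) isT).
have [o2 /andP[o2_ge0 o2_run] o2_min] := arg_minP F P_o1.
exists (F o2); split=> // s /andP[s_ge0 s_lt].
(* Rounding s down to the nearest candidate leaves the set of running batches unchanged. *)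
have [o3 o3_le o3_max] := arg_maxP F (s_ge0 : (fun o => F o <= s) None).
have -> : running c p Y s = running c p Y (F o3).
  congr #|pred_of_set _|; apply/setP => i; rewrite !inE.
  apply/idP/idP; first exact: le_lt_trans.
  apply: contraTT; rewrite -!leNgt => le_s.
  exact: (o3_max (Some i)).
rewrite ltnNge; apply/negP => o3_run.
have /o2_min /(lt_le_trans s_lt) : P o3 by rewrite /P o3_run (o3_max None s_ge0 : 0 <= F o3).
by rewrite ltNge o3_le.
Qed.

Lemma phase_exists (R : realType) (J : finType) (m : nat) (c : {set J} -> R)
    (p : J -> R) (q : nat) (b : R) (X Y : {ffun 'I_m -> {set J}})
    (st : state R J) :
  (forall Z, 0 <= c Z) -> phase_partition b X (uncompleted st) Y ->
  exists st', phase c p q b X st st'.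
Proof.
move=> c_ge0 partY; have [t t_pre] := preemption_time_exists c p q Y.
have out i : exists Dr, batch_outcome c p (Y i) t Dr.1 Dr.2.
  rewrite /batch_outcome; have [le_t|/ltW t_le] := leP (proc_time c p (Y i)) t.
    by exists (Y i, proc_time c p (Y i)).
  have max_ge0 : 0 <= max_exec p (Y i) by apply: bigmax_ge_id.
  (* Any admissible outcome will do. The constraints bound the completed work only from below, so
     all of [Y i] may count as completed at time t. *)
  exists (Y i, t); split=> //=; first by rewrite (le_trans t_le) // lerDl.
  by rewrite lerDl addr_ge0.
have [Dr DrP] := fin_all_exists out.
by eexists; exists Y, t, (fun i => (Dr i).1), (fun i => (Dr i).2); split.
Qed.

Lemma phase_uncompleted_cover (R : realType) (J : finType) (m : nat)
    (c : {set J} -> R) (p : J -> R) (q : nat) (b : R)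
    (X : {ffun 'I_m -> {set J}}) (st st' : state R J) :
  phase c p q b X st st' ->
  exists (Y : {ffun 'I_m -> {set J}}) (I : {set 'I_m}),
    [/\ phase_partition b X (uncompleted st) Y, (#|I| <= m %/ q)%N
      & uncompleted st' \subset \bigcup_(i in I) Y i].
Proof.
case=> Y [t [D [r [partY [_ run_le _] out ->]]]].
exists Y, [set i : 'I_m | t < proc_time c p (Y i)]; split=> //.
apply/subsetP => x; rewrite inE => /andP[xD].
rewrite -(mpartition_cover partY.1) => /bigcupP[i _ xYi].
apply/bigcupP; exists i => //; rewrite inE ltNge.
apply: contra xD => le_t; apply/bigcupP; exists i => //.
by have := out i; rewrite /batch_outcome le_t => -[-> _].
Qed.

(** Enumerate S and cut the list into consecutive runs of length b; the label of a job is its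
    position divided by b. For b = 0 the set is empty. *)
Lemma exists_small_fibers (J : finType) (S : {set J}) (q b : nat) :
  (#|S| <= q * b)%N ->
  exists f : J -> nat, {in S, forall x, (f x < q)%N} /\
    forall v, (#|[set x in S | f x == v]| <= b)%N.
Proof.
case: b => [|b] S_le.
  have -> : S = set0 by apply/eqP; rewrite -cards_eq0 -leqn0 -(muln0 q).
  exists (fun=> 0%N); split=> [x|v]; first by rewrite inE.
  by rewrite (_ : [set _ in _ | _] = set0) ?cards0 //; apply/setP => x; rewrite !inE.
exists (fun x => index x (enum S) %/ b.+1)%N; split=> [x xS|v].
  by rewrite ltn_divLR // (leq_trans _ S_le) // cardE index_mem mem_enum.
(* Within a fiber the quotient is fixed, so the remainder determines the position and maps the fiber
   injectively into [b.+1] values. *)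
rewrite -[leqRHS]card_ord -(card_in_imset (f := fun x =>
  Ordinal (ltn_pmod (index x (enum S)) (ltn0Sn b)))); first exact: max_card.
move=> x y; rewrite !inE => /andP[xS /eqP xv] /andP[yS /eqP yv] [eq_mod].
apply: (index_inj x (s := enum S)); rewrite ?mem_enum //=.
by rewrite (divn_eq (index x (enum S)) b.+1) xv eq_mod -yv -divn_eq.
Qed.

(* Each of the at most [m %/ q] blocks left is cut into [q] pieces; piece [v] of
   the block with rank [u] goes to machine [u * q + v]. *)
Lemma split_blocks (J : finType) (m q b : nat) (W : {set J}) (I : {set 'I_m})
    (Y : 'I_m -> {set J}) :
  (0 < m)%N -> (#|I| <= m %/ q)%N -> W \subset \bigcup_(i in I) Y i ->
  (forall i, #|Y i| <= q * b)%N ->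
  exists Z : {ffun 'I_m -> {set J}}, mpartition W Z /\
    forall l, (#|Z l| <= b)%N /\ exists i, Z l \subset Y i.
Proof.
case: m I Y => // m I Y _ I_le W_sub Y_le.
have [f f_lt] := fin_all_exists (fun i => exists_small_fibers (Y_le i)).
have g_ex x : exists i, x \in W -> i \in I /\ x \in Y i.
  case xW: (x \in W); last by exists ord0.
  by have /bigcupP[i] := subsetP W_sub _ xW; exists i.
have [g gP] := fin_all_exists g_ex.
pose label x := (index (g x) (enum I) * q + f (g x) x)%N.
(* A rank u < |I| <= [m %/ q] gives (u + 1) q <= m, and the piece number is below q. *)
have label_lt x : x \in W -> (label x < m.+1)%N.
  move=> /gP[gI xY]; have fx_lt := (f_lt (g x)).1 x xY.
  have : (index (g x) (enum I) < #|I|)%N by rewrite cardE index_mem mem_enum.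
  move=> /leq_trans/(_ I_le); rewrite leq_divRL ?(leq_ltn_trans _ fx_lt) //.
  by apply: leq_trans; rewrite /label mulSn [in ltnRHS]addnC ltn_add2l.
exists [ffun l => [set x in W | inord (label x) == l]].
split=> [|l]; first exact: fibers_mpartition.
rewrite ffunE; set Z := [set x in W | _].
have [->|[x0]] := set_0Vmem Z; first by rewrite cards0; split=> //; exists ord0; rewrite sub0set.
rewrite inE => /andP[x0W /eqP x0l].
have [g0I x0Y] := gP _ x0W.
(* Quotient and remainder of the label by q recover the block and the piece, so a machine receives
   jobs of a single piece. *)
have Z_sub : Z \subset [set x in Y (g x0) | f (g x0) x == f (g x0) x0].
  apply/subsetP => x; rewrite [x \in Z]inE => /andP[xW].
  have [gI xY] := gP _ xW.
  rewrite -x0l -val_eqE /= !inordK ?label_lt // => /eqP eq_label.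
  have lt0 := (f_lt (g x0)).1 x0 x0Y; have lt := (f_lt (g x)).1 x xY.
  have q_gt0 : (0 < q)%N by apply: leq_ltn_trans lt0.
  have eq_g : g x = g x0.
    apply: (index_inj ord0 (s := enum I)); rewrite ?mem_enum //.
    have := congr1 (divn^~ q) eq_label.
    by rewrite /label !divnMDl // !divn_small // !addn0.
  rewrite inE -eq_g xY /=; have := congr1 (modn^~ q) eq_label.
  by rewrite /label !modnMDl !modn_small // -eq_g => ->.
split; first exact: leq_trans (subset_leq_card Z_sub) ((f_lt _).2 _).
exists (g x0); apply: subset_trans Z_sub _.
by apply/subsetP => x; rewrite inE => /andP[].
Qed.

Lemma size_bound_upE (R : realType) (n q k : nat) :
  exists b : nat, size_bound_up R n q k = b%:R.
Proof.
exists `|Num.ceil (size_bound R n q k)|%N.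
rewrite /size_bound_up natr_absz ger0_norm // ceil_ge0.
by rewrite (lt_le_trans (ltrN10 R)) // divr_ge0 // exprn_ge0.
Qed.

Lemma size_bound_le_up (R : realType) (n q k : nat) :
  size_bound R n q k <= size_bound_up R n q k.
Proof. exact: ceil_ge. Qed.

(** The right side is an integer not below n / q^k, hence not below its ceiling. Thus rounding up is
    compatible with cutting a batch into q pieces. *)
Lemma size_bound_up_le_mul (R : realType) (n q k : nat) :
  (0 < q)%N -> size_bound_up R n q k <= q%:R * size_bound_up R n q k.+1.
Proof.
move=> q_gt0; have [b bE] := size_bound_upE R n q k.+1.
have -> : q%:R * size_bound_up R n q k.+1 = (q * b)%:Z%:~R by rewrite bE -natrM.
rewrite ler_int ceil_le_int.
have -> : (q * b)%:Z%:~R = q%:R * size_bound_up R n q k.+1 by rewrite bE -natrM.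
apply: le_trans (ler_wpM2l _ (size_bound_le_up R n q k.+1)); last exact: ler0n.
have q0 : q%:R != 0 :> R by rewrite pnatr_eq0 -lt0n.
rewrite /size_bound exprS invfM mulrCA (mulrA q%:R) mulfV // mul1r.
exact: lexx.
Qed.

Lemma next_partition (R : realType) (J : finType) (m : nat) (c : {set J} -> R)
    (p : J -> R) (q : nat) (X : {ffun 'I_m -> {set J}}) (k : nat)
    (st : state R J) :
  (0 < m)%N -> (0 < q)%N -> mpartition [set: J] X ->
  reached c p q (size_bound_up R #|J| q) X k st ->
  exists Y, phase_partition (size_bound_up R #|J| q k) X (uncompleted st) Y.
Proof.
move=> m_gt0 q_gt0 partX.
case=> [|{}k {}st st' _ /phase_uncompleted_cover[Y [I [[_ Y_le] I_le U_sub]]]].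
  (* The first phase can use X itself, since its size bound is n. *)
  exists X; split=> // i; split; last by exists i.
  apply: le_trans (size_bound_le_up R _ _ _).
  by rewrite /size_bound expr0 divr1 ler_nat max_card.
have [b bE] := size_bound_upE R #|J| q k.+1.
have Yb_le i : (#|Y i| <= q * b)%N.
  rewrite -(ler_nat R) natrM -bE; apply: le_trans (Y_le i).1 _.
  exact: size_bound_up_le_mul.
have [Z [partZ Z_le]] := split_blocks m_gt0 I_le U_sub Yb_le.
exists Z; split=> // l; have [Zl_le [i Zl_sub]] := Z_le l.
rewrite bE ler_nat; split=> //; have [_ [j Yi_sub]] := Y_le i.
by exists j; apply: subset_trans Zl_sub Yi_sub.
Qed.

Lemma singleton_assignment_exists (J : finType) (m : nat) (U : {set J})
    (Y : {ffun 'I_m -> {set J}}) :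
  (0 < m)%N -> mpartition U Y -> (forall i, #|Y i| <= 1)%N ->
  exists f : J -> 'I_m, singleton_assignment U f.
Proof.
case: m Y => // m Y _ partY Y_le1.
have f_ex x : exists i, x \in U -> x \in Y i.
  case xU: (x \in U); last by exists ord0.
  by move: xU; rewrite -(mpartition_cover partY) => /bigcupP[i]; exists i.
have [f fP] := fin_all_exists f_ex; exists f => x y /fP xY /fP yY eq_f.
by apply: (card_le1_eqP (Y_le1 (f x))) => //; rewrite eq_f.
Qed.

Lemma executable_size_bound_up (R : realType) (J : finType) (m : nat)
    (c : {set J} -> R) (p : J -> R) (q : nat) :
  sUETS_instance m c p -> (0 < q)%N -> (#|J| <= q ^ q)%N ->
  executable m c p q (size_bound_up R #|J| q).
Proof.
move=> [m_ge2 _ c_ge0 _ _ _] q_gt0 n_le _.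
have m_gt0 : (0 < m)%N by lia.
split; first exact: min_setup_exists.
move=> X [partX _]; split=> [k st _ reach|st reach].
  by have [Y /(phase_exists p q c_ge0)] := next_partition m_gt0 q_gt0 partX reach.
(* Phases are numbered from 0, so index q stands for the phase after the last one. Its size bound is
   the ceiling of n / q^q <= 1, so a partition for it has blocks of at most one job. *)
have [Y [partY Y_le]] := next_partition m_gt0 q_gt0 partX reach.
apply: singleton_assignment_exists m_gt0 partY _ => i.
rewrite -(ler_nat R); apply: le_trans (Y_le i).1 _.
rewrite -[1%:R]/(1%:~R) ler_int ceil_le_int /size_bound.
by rewrite ler_pdivrMr ?exprn_gt0 ?ltr0n // mul1r -natrX ler_nat.
Qed.

Theorem theorem5 (R : realType) :
  exists C : R,
  forall (J : finType) (m : nat) (c : {set J} -> R) (p : J -> R) (q : nat),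
    sUETS_instance m c p ->
    is_base #|J| q ->
    0 < rate R #|J| ->
    [/\ forall T : R, makespan m c p q (size_bound R #|J| q) T ->
          T <= C * rate R #|J| * opt_makespan m c p,
        executable m c p q (size_bound_up R #|J| q)
      & forall T : R, makespan m c p q (size_bound_up R #|J| q) T ->
          T <= C * rate R #|J| * opt_makespan m c p].
Proof.
(* 48 = 6 * 8, from [makespan_le] and [is_base_le_rate]. *)
exists 48 => J m c p q inst base rate_gt0.
have m_gt0 : (0 < m)%N by case: inst => m_ge2 *; lia.
have n_le : (#|J| <= q ^ q)%N by case/andP: base.
(* Since [0 ^ 0 = 1], q = 0 would require 1 < n <= 1. *)
have q_gt0 : (0 < q)%N by case: q base {n_le}; rewrite /is_base //=; case: #|J| => [|[]].
have T_le bound T : makespan m c p q bound T ->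
    T <= 48 * rate R #|J| * opt_makespan m c p.
  move=> /(makespan_le inst q_gt0)/le_trans; apply.
  rewrite ler_wpM2r ?opt_makespan_ge0 //.
  by have := is_base_le_rate base rate_gt0; lra.
by split=> [T||T]; [exact: T_le | exact: executable_size_bound_up | exact: T_le].
Qed.
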